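(* Consider the noisy search problem and the sorted Posterior Matching strategy ($sortPM$) described in the context, run with the variable-length stopping rule. For resolution $\delta>0$ and reliability $0<\epsilon<1$, the expected search time satisfies $$\mathbb{E}[\tau_{\epsilon,\delta}] \le \frac{\log(1/\delta)}{I(1/2,\,p[\alpha])} + \frac{\log(1/\epsilon)}{C_1(p[\delta])} + o\Big(\log\frac{1}{\delta\epsilon}\Big),$$ for any fixed $\alpha > \big(e\log\frac{1}{\delta\epsilon}\big)^{-K_s}$, where $$K_s := \max\Big\{\tfrac12 D\big(\tfrac14 B_1+\tfrac34 B_0 \,\big\|\, B_0\big),\ \tfrac18 D\big(B_1 \,\big\|\, \tfrac34 B_1+\tfrac14 B_0\big)\Big\}>0,$$ with $B_1=\mathrm{Bern}(1-p[1/2])$, $B_0=\mathrm{Bern}(p[1/2])$.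
   Context: Search problem: fix $\delta\in(0,1)$ with $N=1/\delta$ an integer. A target index $\theta$ is uniformly distributed on $\{1,\dots,N\}$. A noise profile $p:(0,1)\to(0,1/2)$ is continuous and non-decreasing; write $p[x]:=p(x)$. At each time $t=1,2,\dots$ an agent chooses a query set $S_t\subseteq\{1,\dots,N\}$ as a function of past queries and observations, and observes $Y_t=\mathbb{1}(\theta\in S_t)\oplus Z_t$ ($\oplus$ = XOR), where conditionally on $S_t$, $Z_t\sim\mathrm{Bern}(p[\delta|S_t|])$, conditionally i.i.d. across time. The posterior is $\pi_i(t)=\mathbb{P}(\theta=i\mid S_1,\dots,S_t,Y_1,\dots,Y_t)$ with $\pi_i(0)=\delta$; for $S\subseteq\{1,\dots,N\}$ write $\pi_S=\sum_{i\in S}\pi_i$. Variable-length stopping rule: $\tau_{\epsilon,\delta}$ is the first $t$ with $\max_i\pi_i(t)>1-\epsilon$, and the estimate is $\hat\theta=\arg\max_i\pi_i(\tau)$. $sortPM$: at time $t$, let $\sigma_t$ be a permutation ranking the entries of $\pi(t)$ in descending order ($\sigma_t(i)=j$ means $\pi_i(t)$ is the $j$-th largest entry $\pi^{\downarrow}_j(t)$). Let $k^*=\arg\min_k\big|\sum_{j=1}^k\pi^{\downarrow}_j(t)-\tfrac12\big|$ and query $S_{t+1}=\{i:\sigma_t(i)\in\{1,\dots,k^*\}\}$. Notation: $D(P\|Q)=\sum_x P(x)\log\frac{P(x)}{Q(x)}$ is KL divergence; a convex combination of Bernoulli distributions denotes their mixture. $I(q,p)$ is the mutual information between input $X\sim\mathrm{Bern}(q)$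 and the output of a binary symmetric channel with crossover probability $p$. $C_1(p):=D(\mathrm{Bern}(p)\|\mathrm{Bern}(1-p))$. The $o(\cdot)$ term is as $\delta\to0$ or $\epsilon\to0$. *)

(* Defs.v *)
From HB Require Import structures.
From mathcomp Require Import all_boot all_order all_algebra all_fingroup.
From mathcomp Require Import all_classical all_reals all_analysis.
Set Implicit Arguments. Unset Strict Implicit. Unset Printing Implicit Defensive.
Import Order.TTheory GRing.Theory Num.Theory.
Local Open Scope ring_scope.

Section NoisySearch.
Variable R : realType.

Definition Bern (a : R) : bool -> R := fun x => if x then a else 1 - a.
Definition mix (w : R) (P Q : bool -> R) : bool -> R :=
  fun x => w * P x + (1 - w) * Q x.
Definition KL (P Q : bool -> R) : R := \sum_(x : bool) P x * ln (P x / Q x).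
Definition BSC (p : R) (x y : bool) : R := if y == x then 1 - p else p.
Definition MI (q p : R) : R :=
  let PXY := fun x y => Bern q x * BSC p x y in
  let PY := fun y => \sum_(x : bool) PXY x y in
  \sum_(x : bool) \sum_(y : bool) PXY x y * ln (PXY x y / (Bern q x * PY y)).
Definition C1 (p : R) : R := KL (Bern p) (Bern (1 - p)).
Definition Ks (p : R -> R) : R :=
  let B1 := Bern (1 - p (1/2)) in
  let B0 := Bern (p (1/2)) in
  Num.max (1/2 * KL (mix (1/4) B1 B0) B0) (1/8 * KL B1 (mix (3/4) B1 B0)).

(* ---------- the search model, N = 1/delta ---------- *)
Variable N : nat.

(* P(Y = y | theta = i, query S): Y = 1(i in S) xor Z, Z ~ Bern(p[delta |S|]) *)
Definition lik (p : R -> R) (S : {set 'I_N}) (i : 'I_N) (y : bool) : R :=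
  let q := p (#|S|%:R / N%:R) in if y == (i \in S) then 1 - q else q.

Definition mass (pi : 'I_N -> R) (S : {set 'I_N}) : R := \sum_(i in S) pi i.

Definition normalize (w : 'I_N -> R) : 'I_N -> R :=
  fun i => w i / \sum_(j : 'I_N) w j.

Definition topk (sigma : {perm 'I_N}) (k : nat) : {set 'I_N} :=
  [set i | (sigma i < k)%N].
Definition is_sortPM_query (pi : 'I_N -> R) (S : {set 'I_N}) : Prop :=
  exists sigma : {perm 'I_N},
    (forall i i' : 'I_N, (sigma i < sigma i')%N -> pi i' <= pi i) /\
    exists k : nat, [/\ (1 <= k <= N)%N,
      (forall k' : nat, (1 <= k' <= N)%N ->
         `|mass pi (topk sigma k) - 1/2| <= `|mass pi (topk sigma k') - 1/2|)
      & S = topk sigma k].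

(* joint weights P(theta = i, Y_1..Y_t = ys) when the query at each step is
   sel(current posterior); starts at pi_i(0) = delta = 1/N *)
Definition step (p : R -> R) (sel : ('I_N -> R) -> {set 'I_N})
  (w : 'I_N -> R) (y : bool) : 'I_N -> R :=
  let S := sel (normalize w) in fun i => w i * lik p S i y.
Definition joint (p : R -> R) (sel : ('I_N -> R) -> {set 'I_N})
  (ys : seq bool) : 'I_N -> R :=
  foldl (step p sel) (fun _ => 1 / N%:R) ys.
Definition post p sel ys : 'I_N -> R := normalize (joint p sel ys).

Definition stopb (eps : R) (pi : 'I_N -> R) : bool := [exists i, pi i > 1 - eps].

Definition tail_prob p sel (eps : R) (t : nat) : R :=
  \sum_(ys : t.-tuple bool)
    (\sum_(i : 'I_N) joint p sel ys i) *
    ([forall s : 'I_t.+1, ~~ stopb eps (post p sel (take s ys))])%:R.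

(* E[tau] = sum_{t >= 0} P(tau > t)  (in the extended reals) *)
Definition Etau p sel (eps : R) : \bar R :=
  (\sum_(t <oo) (tail_prob p sel eps t)%:E)%E.

End NoisySearch.

(* Main.v *)
(* Lyapunov argument. One nonnegative potential of the posterior is built whose
   conditional expectation drops by at least 1 at every step before stopping;
   its initial value then bounds E[tau]. The potential is a weighted sum of four
   functionals, each with nonpositive drift at every state; q is a small constant
   fixed by eta, and the states are split by the largest atom pi_max.
   - pi_max > 1 - q: the top element is queried alone and its log-odds drift up
     by (2 pi_max - 1) C1(p[delta]); this pays log(1/eps)/C1. Below log((1-q)/q)
     the log-odds are truncated, which makes that functional flat elsewhere.
   - q <= pi_max <= 1 - q: the martingale pi_max keeps a constant conditional
     variance, so the bounded functional 1 - sum pi_i^2 drops by a constant; only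
     O(1) such steps occur.
   - pi_max < q and |S| <= alpha N: the queried mass is within q of 1/2, so the
     entropy drops by at least I(1/2, p[alpha]) - q; this pays log N / I.
   - pi_max < q and |S| > alpha N: half of the mass sits on atoms of size at most
     1/(alpha N), so N^(-1/2) sum sqrt(pi_i) is bounded below; since it contracts
     by a constant (Hellinger affinity), again only O(1) such steps occur.
   As alpha is fixed while L grows, this last point replaces the quantitative
   bound with the exponent Ks. *)

Require Import Defs.
From HB Require Import structures.
From mathcomp Require Import all_boot all_order all_algebra all_fingroup.
From mathcomp Require Import all_classical all_reals all_analysis.
From mathcomp Require Import ring lra.
Set Implicit Arguments. Unset Strict Implicit. Unset Printing Implicit Defensive.
Import Order.TTheory GRing.Theory Num.Theory.
Import numFieldNormedType.Exports.
Local Open Scope classical_set_scope.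
Local Open Scope ring_scope.

(** * Elementary inequalities for binary divergences, [MI] and [C1] *)

Section BinaryInformation.
Context {R : realType}.
Implicit Types a b e x : R.

Lemma sum_bool (F : bool -> R) : \sum_y F y = F true + F false.
Proof. exact: big_bool. Qed.

Lemma ln_lt_sub1 x : 0 < x -> x != 1 -> ln x < x - 1.
Proof.
move=> x0 x1; have lx0 : ln x != 0 by rewrite ln_eq0.
by have := expR_gt1Dx lx0; rewrite lnK ?posrE // ltrBrDl.
Qed.

Lemma ln_le_sub1 x : 0 < x -> ln x <= x - 1.
Proof.
move=> x0; have [->|x1] := eqVneq x 1; first by rewrite ln1 subrr.
exact/ltW/ln_lt_sub1.
Qed.

(** Pointwise Gibbs inequality: summed over two laws of equal total mass, the left sides cancel. *)
Lemma xlnx_div_ge a b : 0 < a -> 0 < b -> a - b <= a * ln (a / b).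
Proof.
move=> a0 b0; have ba : 0 < b / a by rewrite divr_gt0.
rewrite -[a / b]invf_div lnV ?posrE // mulrN lerNr opprB.
have := ler_wpM2l (ltW a0) (ln_le_sub1 ba).
suff -> : a * (b / a - 1) = b - a by [].
by field; rewrite gt_eqF.
Qed.

Lemma xlnx_div_gt a b : 0 < a -> 0 < b -> a != b -> a - b < a * ln (a / b).
Proof.
move=> a0 b0 ab; have ba : 0 < b / a by rewrite divr_gt0.
have ba1 : b / a != 1.
  by apply: contraNneq ab => /divr1_eq ->.
rewrite -[a / b]invf_div lnV ?posrE // mulrN ltrNr opprB.
have : a * ln (b / a) < a * (b / a - 1) by rewrite ltr_pM2l // ln_lt_sub1.
suff -> : a * (b / a - 1) = b - a by [].
by field; rewrite gt_eqF.
Qed.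

Lemma gibbs (P Q : bool -> R) : (forall y, 0 < P y) -> (forall y, 0 < Q y) ->
  \sum_y P y = \sum_y Q y -> 0 <= KL P Q.
Proof.
rewrite /KL !sum_bool => P0 Q0 PQ.
have := xlnx_div_ge (P0 true) (Q0 true); have := xlnx_div_ge (P0 false) (Q0 false).
lra.
Qed.

Lemma KL_gt0 (P Q : bool -> R) : (forall y, 0 < P y) -> (forall y, 0 < Q y) ->
  \sum_y P y = \sum_y Q y -> P true != Q true -> 0 < KL P Q.
Proof.
rewrite /KL !sum_bool => P0 Q0 PQ ne.
have := xlnx_div_gt (P0 true) (Q0 true) ne.
have := xlnx_div_ge (P0 false) (Q0 false).
lra.
Qed.

Lemma Ks_gt0 (p : R -> R) : 0 < p (1/2) < 1/2 -> 0 < Ks p.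
Proof.
rewrite /Ks; set e := p _ => /andP[e0 e1].
rewrite lt_max; apply/orP; right; apply: mulr_gt0; first lra.
apply: KL_gt0 => [y|y||]; rewrite ?sum_bool /mix /Bern /=; try (case: y); try lra.
Qed.

Lemma MI_half e : 0 < e < 1 ->
  MI (1/2) e = ln 2 + e * ln e + (1 - e) * ln (1 - e).
Proof.
move=> /andP[e0 e1]; rewrite /MI !sum_bool /Bern /BSC /=.
have lnE x : 0 < x -> ln (x * 2) = ln x + ln 2.
  by move=> x0; rewrite lnM ?posrE.
have E x : 0 < x -> 1/2 * x / (1/2 * (1/2)) = x * 2 by move=> x0; field.
have H1 : 1/2 * (1 - e) + (1 - 1/2) * e = 1/2 by field.
have H2 : 1/2 * e + (1 - 1/2) * (1 - e) = 1/2 by field.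
have H3 : (1 - 1/2 : R) = 1/2 by field.
rewrite H1 H2 H3 !E ?subr_gt0 // !lnE ?subr_gt0 //; by field.
Qed.

Lemma MI_half_gt0 e : 0 < e < 1/2 -> 0 < MI (1/2) e.
Proof.
move=> /andP[e0 e1]; rewrite MI_half; last by apply/andP; split; lra.
have h0 : (0 : R) < 1/2 by lra.
have f0 : 0 < 1 - e by lra.
have eh : e != 1/2 by apply/eqP; lra.
have := xlnx_div_gt e0 h0 eh; have := xlnx_div_ge f0 h0.
rewrite !ln_div ?posrE // ln1; lra.
Qed.

(** The difference of the two sides is the divergence of Bern(a) from Bern(b) plus (b - a) (ln (1 -
    b) - ln b), and both terms are nonnegative. *)
Lemma MI_half_anti a b : 0 < a -> a <= b -> b < 1/2 -> MI (1/2) b <= MI (1/2) a.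
Proof.
move=> a0 ab b1; rewrite !MI_half; try by apply/andP; split; lra.
have b0 : 0 < b by lra.
have b0' : 0 < 1 - b by lra.
have a0' : 0 < 1 - a by lra.
have := xlnx_div_ge a0 b0; have := xlnx_div_ge a0' b0'.
rewrite !ln_div ?posrE //.
have : ln b <= ln (1 - b) by rewrite ler_ln ?posrE //; lra.
nra.
Qed.

Lemma C1E e : 0 < e < 1 -> C1 e = (1 - 2 * e) * ln ((1 - e) / e).
Proof.
move=> /andP[e0 e1]; have f0 : 0 < 1 - e by lra.
rewrite /C1 /KL sum_bool /Bern (_ : 1 - (1 - e) = e); last by ring.
rewrite !ln_div ?posrE //; ring.
Qed.

Lemma ln_odds_gt0 e : 0 < e < 1/2 -> 0 < ln ((1 - e) / e).
Proof.
by move=> /andP[e0 e1]; rewrite ln_gt0 // ltr_pdivlMr //; lra.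
Qed.

Lemma C1_gt0 e : 0 < e < 1/2 -> 0 < C1 e.
Proof.
move=> e01; rewrite C1E; last by case/andP: e01 => *; apply/andP; split; lra.
by apply: mulr_gt0 (ln_odds_gt0 e01); case/andP: e01 => *; lra.
Qed.

Lemma C1_anti a b : 0 < a -> a <= b -> b < 1/2 -> C1 b <= C1 a.
Proof.
move=> a0 ab b1; rewrite !C1E; try by apply/andP; split; lra.
have b0 : 0 < b by lra.
apply: ler_pM; try lra.
  by apply/ltW/ln_odds_gt0; rewrite b0.
rewrite ler_ln ?posrE ?divr_gt0 //; try lra.
rewrite ler_pdivrMr // mulrAC ler_pdivlMr //; nra.
Qed.

(** With u, v the square roots, a - b = (u + v)(u - v) and u + v <= 2. This converts a gap between
    probabilities into a Hellinger deficit. *)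
Lemma sqrt_gap (a b : R) : 0 <= a <= 1 -> 0 <= b <= 1 ->
  (a - b) ^+ 2 <= 4 * (a + b - 2 * Num.sqrt (a * b)).
Proof.
move=> /andP[a0 a1] /andP[b0 b1]; rewrite sqrtrM //.
have ua := sqr_sqrtr a0; have ub := sqr_sqrtr b0.
have u0 := sqrtr_ge0 a; have v0 := sqrtr_ge0 b.
have u1 : Num.sqrt a <= 1 by rewrite -sqrtr1 ler_wsqrtr.
have v1 : Num.sqrt b <= 1 by rewrite -sqrtr1 ler_wsqrtr.
move: ua ub u0 v0 u1 v1; move: (Num.sqrt a) (Num.sqrt b) => u v <- <- u0 v0 u1 v1.
have -> : (u ^+ 2 - v ^+ 2) ^+ 2 = (u + v) ^+ 2 * (u - v) ^+ 2 by ring.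
have -> : 4 * (u ^+ 2 + v ^+ 2 - 2 * (u * v)) = 4 * (u - v) ^+ 2 by ring.
by apply: ler_wpM2r; [exact: sqr_ge0|nra].
Qed.

End BinaryInformation.

(** * Expected change of entropy, root sum and square sum under a Bayes update *)

Section BayesDrift.
Context {R : realType} {I : finType}.
Variables (pi : I -> R) (l : I -> bool -> R).
Hypothesis pi_gt0 : forall i, 0 < pi i.
Hypothesis pi_sum : \sum_i pi i = 1.
Hypothesis l_gt0 : forall i y, 0 < l i y.
Hypothesis l_sum : forall i, l i true + l i false = 1.

(** The predictive law of the next observation, which is the denominator in Bayes' rule. *)
Definition outp y := \sum_i pi i * l i y.
Definition bayes y i := pi i * l i y / outp y.
Definition entropy (mu : I -> R) := - \sum_i mu i * ln (mu i).

Lemma outp_gt0 y : 0 < outp y.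
Proof.
have [i _|noI] := pickP (@predT I); last first.
  by move: pi_sum; rewrite (eq_bigl _ _ noI) big_pred0_eq => /eqP; rewrite eq_sym oner_eq0.
rewrite /outp (bigD1 i) //=; apply: ltr_wpDr; last by rewrite mulr_gt0.
by apply: sumr_ge0 => j _; rewrite mulr_ge0 // ltW.
Qed.

Lemma outp_sum : outp true + outp false = 1.
Proof.
rewrite -big_split /= -pi_sum; apply: eq_bigr => i _.
by rewrite -mulrDr l_sum mulr1.
Qed.

(** Chain rule: the expected loss is the mutual information, written as the mean divergence of the
    channel rows from the output law. *)
Lemma entropy_bayes : \sum_y outp y * entropy (bayes y) =
  entropy pi - \sum_i pi i * KL (l i) outp.
Proof.
have E y : outp y * entropy (bayes y) =
    - \sum_i (pi i * l i y * ln (pi i) + pi i * (l i y * ln (l i y / outp y))).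
  rewrite /entropy mulrN mulr_sumr; congr (- _); apply: eq_bigr => i _.
  rewrite mulrA /bayes -[in X in ln X]mulrA lnM ?posrE ?divr_gt0 ?outp_gt0 //.
  have := outp_gt0 y; move: (outp y) => P P0; field; rewrite ?gt_eqF //.
rewrite (eq_bigr _ (fun y _ => E y)) sum_bool /entropy -!opprD; congr (- _).
rewrite -!big_split /=; apply: eq_bigr => i _.
rewrite /KL sum_bool.
transitivity (pi i * (l i true + l i false) * ln (pi i) +
  pi i * (l i true * ln (l i true / outp true) +
          l i false * ln (l i false / outp false))); first by ring.
by rewrite l_sum mulr1.
Qed.

Lemma entropy_bayes_le : \sum_y outp y * entropy (bayes y) <= entropy pi.
Proof.
rewrite entropy_bayes gerBl; apply: sumr_ge0 => i _.
apply: mulr_ge0; first exact: ltW.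
by apply: gibbs => [y|y|]; rewrite ?outp_gt0 // !sum_bool l_sum outp_sum.
Qed.

Lemma outp_le1 y : outp y <= 1.
Proof.
have := outp_gt0 true; have := outp_gt0 false; have := outp_sum.
by case: y; lra.
Qed.

Lemma l_le1 i y : l i y <= 1.
Proof.
have := l_gt0 i true; have := l_gt0 i false; have := l_sum i.
by case: y; lra.
Qed.

(** Coordinate i is multiplied by the Hellinger affinity of [l i] and [outp]. The gap is the same
    for both observations, so [sqrt_gap] applied twice puts this affinity below 1 - k. *)
Lemma sum_sqrt_bayes_le k : (forall i, 4 * k <= (l i true - outp true) ^+ 2) ->
  \sum_y outp y * (\sum_i Num.sqrt (bayes y i)) <= (1 - k) * \sum_i Num.sqrt (pi i).
Proof.
move=> hk.
have E y : outp y * (\sum_i Num.sqrt (bayes y i)) =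
    \sum_i Num.sqrt (pi i) * Num.sqrt (l i y * outp y).
  rewrite mulr_sumr; apply: eq_bigr => i _.
  rewrite -[outp y in LHS](@sqr_sqrtr _ (outp y)) ?ltW ?outp_gt0 //.
  rewrite /bayes sqrtrM ?mulr_ge0 ?ltW // sqrtrV ?sqrtrM ?ltW ?outp_gt0 //.
  have : 0 < Num.sqrt (outp y) by rewrite sqrtr_gt0 outp_gt0.
  by move=> P0; field; rewrite gt_eqF.
rewrite (eq_bigr _ (fun y _ => E y)) sum_bool -big_split /= mulr_sumr.
apply: ler_sum => i _; rewrite -mulrDr mulrC.
apply: ler_wpM2r; first exact: sqrtr_ge0.
have bnd y : 0 <= l i y <= 1 by rewrite ltW //= l_le1.
have bnP y : 0 <= outp y <= 1 by rewrite ltW ?outp_gt0 //= outp_le1.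
have := sqrt_gap (bnd true) (bnP true); have := sqrt_gap (bnd false) (bnP false).
have -> : (l i false - outp false) ^+ 2 = (l i true - outp true) ^+ 2.
  have -> : l i false = 1 - l i true by rewrite -(l_sum i); ring.
  have -> : outp false = 1 - outp true by rewrite -outp_sum; ring.
  by ring.
have := hk i; have := l_sum i; have := outp_sum; lra.
Qed.

(** Coordinate i is multiplied by 1 plus a chi-square divergence; the gain is kept at [j] only and
    bounded by 0 elsewhere. *)
Lemma sum_sqr_bayes_ge j : \sum_i pi i ^+ 2 +
    pi j ^+ 2 * (l j true - outp true) ^+ 2 <=
  \sum_y outp y * (\sum_i bayes y i ^+ 2).
Proof.
have E y : outp y * (\sum_i bayes y i ^+ 2) =
    \sum_i pi i ^+ 2 * (l i y ^+ 2 / outp y).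
  rewrite mulr_sumr; apply: eq_bigr => i _; rewrite /bayes.
  by have := outp_gt0 y; move: (outp y) => P P0; field; rewrite gt_eqF.
(* Exactly, l^2 / P = 2 l - P + (l - P)^2 / P, and P <= 1. *)
have key i y : 2 * l i y - outp y + (l i y - outp y) ^+ 2 <= l i y ^+ 2 / outp y.
  have P0 := outp_gt0 y; have P1 := outp_le1 y.
  rewrite ler_pdivlMr //; have := sqr_ge0 (l i y - outp y); nra.
have keyi i : 1 + (l i true - outp true) ^+ 2 <=
    l i true ^+ 2 / outp true + l i false ^+ 2 / outp false.
  have := key i true; have := key i false; have := l_sum i; have := outp_sum.
  have := sqr_ge0 (l i false - outp false); lra.
rewrite (eq_bigr _ (fun y _ => E y)) sum_bool -big_split /=.
rewrite (bigD1 j) //= [leRHS](bigD1 j) //= [leLHS]addrAC; apply: lerD.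
  rewrite -[leRHS]mulrDr -[X in X + _ <= _]mulr1 -mulrDr.
  by apply: ler_wpM2l; [exact: sqr_ge0|exact: keyi].
apply: ler_sum => i _; rewrite -mulrDr -[leLHS]mulr1.
apply: ler_wpM2l; first exact: sqr_ge0.
by have := keyi i; have := sqr_ge0 (l i true - outp true); lra.
Qed.

End BayesDrift.

(** * Binary symmetric observations of a query set *)

Section SymmetricNoise.
Context {R : realType} {I : finType}.
Variables (pi : I -> R) (S : {set I}) (e : R).
Hypothesis pi_gt0 : forall i, 0 < pi i.
Hypothesis pi_sum : \sum_i pi i = 1.
Hypothesis e_range : 0 < e < 1/2.

(** Agrees with [lik] by conversion once [e] is the noise at the query size; freeing [e] separates
    the channel estimates from that size. *)
Definition bsc i y := if y == (i \in S) then 1 - e else e.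
Let m := \sum_(i in S) pi i.

Lemma bsc_gt0 i y : 0 < bsc i y.
Proof. by move: e_range => /andP[e0 e1]; rewrite /bsc; case: ifP => _; lra. Qed.

Lemma bsc_sum i : bsc i true + bsc i false = 1.
Proof. by rewrite /bsc; case: (i \in S) => /=; ring. Qed.

Lemma outp_bsc_true : outp pi bsc true = m * (1 - e) + (1 - m) * e.
Proof.
have -> : 1 - m = \sum_(i | i \notin S) pi i.
  by rewrite -pi_sum (bigID (mem S)) /= addrAC subrr add0r.
rewrite /outp (bigID (mem S)) /= !mulr_suml.
by congr (_ + _); apply: eq_bigr => i iS; rewrite /bsc ?iS // (negbTE iS).
Qed.

Lemma bsc_sub_outp i : bsc i true - outp pi bsc true =
  (if i \in S then 1 - m else - m) * (1 - 2 * e).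
Proof. by rewrite outp_bsc_true /bsc; case: (i \in S) => /=; ring. Qed.

(** The loss is h(P) - h(e), with h the binary entropy and P the probability of observing true. As
    [MI (1/2) e] is ln 2 - h(e), only the deficit ln 2 - h(P) has to be controlled, through 2P - 1 =
    (2m - 1)(1 - 2e). *)
Lemma entropy_bsc_le : \sum_y outp pi bsc y * entropy (bayes pi bsc y) <=
  entropy pi - MI (1/2) e + (2 * m - 1) ^+ 2.
Proof.
move: e_range => /andP[e0 e1].
rewrite entropy_bayes //; [|exact: bsc_gt0|exact: bsc_sum].
have P0 := outp_gt0 pi_gt0 pi_sum bsc_gt0.
have PS := outp_sum pi_sum bsc_sum.
have E i : KL (bsc i) (outp pi bsc) = e * ln e + (1 - e) * ln (1 - e)
    - (bsc i true * ln (outp pi bsc true) + bsc i false * ln (outp pi bsc false)).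
  rewrite /KL sum_bool !ln_div ?posrE ?bsc_gt0 //.
  rewrite /bsc; case: (i \in S) => /=; ring.
have -> : \sum_i pi i * KL (bsc i) (outp pi bsc) = e * ln e + (1 - e) * ln (1 - e)
    - (outp pi bsc true * ln (outp pi bsc true)
       + outp pi bsc false * ln (outp pi bsc false)).
  rewrite /outp !mulr_suml -big_split /= -/(outp pi bsc _) -/(outp pi bsc _).
  rewrite -[X in X - _]mul1r -[X in X * _ - _]pi_sum mulr_suml -sumrB.
  by apply: eq_bigr => i _; rewrite E; ring.
rewrite MI_half; last by apply/andP; split; lra.
have two0 : (0 : R) < 2 by [].
have h0 : (0 : R) < 1/2 by lra.
(* ln (2x) <= 2x - 1 bounds the deficit ln 2 - h(P) by (2P - 1)^2 *)
have lnP y : outp pi bsc y * (ln (outp pi bsc y) + ln 2)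
    <= outp pi bsc y * (2 * outp pi bsc y - 1).
  rewrite -lnM ?posrE //; apply: ler_wpM2l; first exact: ltW.
  by rewrite [_ * 2]mulrC; apply: ln_le_sub1; rewrite mulr_gt0.
have := lnP true; have := lnP false.
have m01 : 0 <= m <= 1.
  apply/andP; split; first by apply: sumr_ge0 => i _; rewrite ltW.
  by rewrite -pi_sum /m [leRHS](bigID (mem S)) /= lerDl sumr_ge0 // => i _; rewrite ltW.
have PF : outp pi bsc false = 1 - outp pi bsc true by rewrite -PS; ring.
have PT := outp_bsc_true.
have D : (2 * outp pi bsc true - 1) ^+ 2 <= (2 * m - 1) ^+ 2.
  have -> : 2 * outp pi bsc true - 1 = (2 * m - 1) * (1 - 2 * e) by rewrite PT; ring.
  rewrite exprMn -[leRHS]mulr1; apply: ler_wpM2l; first exact: sqr_ge0.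
  by rewrite expr_le1 //; lra.
rewrite PF; move: (ln _) (ln _) D; move: (outp pi bsc true) => P lP lF D.
nra.
Qed.

End SymmetricNoise.

(** * Truncated log-odds of the largest atom *)

Section Gap.
Context {R : realType} {I : finType}.
Implicit Types (mu : I -> R).

Definition logit (x : R) := ln (x / (1 - x)).

Lemma ler_logit (x y : R) : 0 < x -> x <= y -> y < 1 -> logit x <= logit y.
Proof.
move=> x0 xy y1; rewrite ler_ln ?posrE ?divr_gt0 //; try lra.
rewrite ler_pdivrMr; last lra.
by rewrite mulrAC ler_pdivlMr; [nra|lra].
Qed.

(** The seed [l0] of the maximum acts as a floor and [top] as a cap: the floor bounds the gap above,
    the cap keeps it nonnegative. *)
Definition gap (l0 top : R) mu :=
  top - \big[Num.max/l0]_i Num.min top (logit (mu i)).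

Lemma gap_ge0 l0 top mu : l0 <= top -> 0 <= gap l0 top mu.
Proof.
move=> l0t; rewrite subr_ge0; apply: bigmax_le => // i _.
by rewrite ge_min lexx.
Qed.

Lemma gap_le l0 top mu : gap l0 top mu <= top - l0.
Proof. by rewrite lerD2l lerN2; exact: bigmax_ge_id. Qed.

Lemma gap_le_logit l0 top mu i : logit (mu i) <= top ->
  gap l0 top mu <= top - logit (mu i).
Proof.
move=> lt; rewrite lerD2l lerN2 -{1}(min_idPr lt).
exact: (le_bigmax_cond _ (fun i => Num.min top (logit (mu i)))).
Qed.

Lemma gap_ge l0 top mu x : l0 <= x -> (forall i, logit (mu i) <= x) ->
  top - x <= gap l0 top mu.
Proof.
move=> l0x lx; rewrite lerD2l lerN2; apply: bigmax_le => // i _.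
by rewrite ge_min lx orbT.
Qed.

Variables (pi : I -> R) (e : R).
Hypothesis pi_gt0 : forall i, 0 < pi i.
Hypothesis pi_sum : \sum_i pi i = 1.
Hypothesis e_range : 0 < e < 1/2.

(** All elements other than i share one likelihood, so the update multiplies the odds of i by (1 -
    e) / e or its inverse. *)
Lemma logit_bayes_singleton i y : pi i < 1 ->
  logit (bayes pi (bsc [set i] e) y i) =
  logit (pi i) + (if y then 1 else -1) * ln ((1 - e) / e).
Proof.
move=> i1; move: (e_range) => /andP[e0 e1].
have P0 := outp_gt0 pi_gt0 pi_sum (bsc_gt0 [set i] e_range) y.
have PT := outp_bsc_true [set i] e pi_sum; rewrite big_set1 in PT.
have PS := outp_sum pi_sum (bsc_sum [set i] e).
have bE : bayes pi (bsc [set i] e) y i / (1 - bayes pi (bsc [set i] e) y i) =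
   pi i / (1 - pi i) * (if y then (1 - e) / e else e / (1 - e)).
  have bi z : bsc [set i] e i z = if z then 1 - e else e.
    by rewrite /bsc finset.in_set1 eqxx; case: z.
  rewrite /bayes bi; case: y P0 => P0.
    rewrite PT in P0 *; field.
    by rewrite !gt_eqF //; nra.
  have PF : outp pi (bsc [set i] e) false = pi i * e + (1 - pi i) * (1 - e).
    by rewrite -(addKr (outp pi (bsc [set i] e) true) (outp _ _ false)) PS PT; ring.
  rewrite PF in P0 *; field.
  by rewrite !gt_eqF //; nra.
rewrite /logit bE lnM ?posrE ?divr_gt0 ?subr_gt0 ?pi_gt0 //; last first.
  by case: y {bE P0}; rewrite divr_gt0 //; lra.
case: y {bE P0}; first by rewrite mul1r.
by rewrite -[e / _]invf_div lnV ?posrE ?divr_gt0 //; [rewrite mulN1r|lra].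
Qed.

(** Following i alone bounds the new gap. Its log-odds jump up or down by ln ((1 - e) / e), with
    mean (2 pi_i - 1)(1 - 2e) times that size; the last hypothesis leaves room below the cap for the
    upward jump. *)
Lemma gap_bayes_le l0 top i : pi i < 1 -> l0 <= logit (pi i) ->
  (forall j, logit (pi j) <= logit (pi i)) ->
  logit (pi i) + ln ((1 - e) / e) <= top ->
  \sum_y outp pi (bsc [set i] e) y * gap l0 top (bayes pi (bsc [set i] e) y)
    <= gap l0 top pi - (2 * pi i - 1) * C1 e.
Proof.
move=> i1 l0i imax itop; have c0 := ln_odds_gt0 e_range.
have P0 := outp_gt0 pi_gt0 pi_sum (bsc_gt0 [set i] e_range).
have PT := outp_bsc_true [set i] e pi_sum; rewrite big_set1 in PT.
have PS := outp_sum pi_sum (bsc_sum [set i] e).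
have G y : gap l0 top (bayes pi (bsc [set i] e) y) <=
    top - (logit (pi i) + (if y then 1 else -1) * ln ((1 - e) / e)).
  rewrite -logit_bayes_singleton //; apply: gap_le_logit.
  rewrite logit_bayes_singleton //; case: y; lra.
have := gap_ge top l0i imax; move: (e_range) => /andP[e0 e1].
rewrite sum_bool C1E; last by apply/andP; split; lra.
have := ler_wpM2l (ltW (P0 true)) (G true).
have := ler_wpM2l (ltW (P0 false)) (G false).
have -> : outp pi (bsc [set i] e) false = 1 - outp pi (bsc [set i] e) true by rewrite -PS; ring.
rewrite PT; move: (gap _ _ _) (gap _ _ _) (gap _ _ _) (logit _) (ln _) => *; lra.
Qed.

End Gap.

(** * Structure of a [sortPM] query *)

Section SortPM.
Context {R : realType} {N : nat}.
Variables (pi : 'I_N -> R) (S : {set 'I_N}).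
Hypothesis N_gt1 : (1 < N)%N.
Hypothesis pi_gt0 : forall i, 0 < pi i.
Hypothesis pi_sum : \sum_i pi i = 1.
Hypothesis S_sortPM : is_sortPM_query pi S.

Let N_gt0 : (0 < N)%N := ltnW N_gt1.

Lemma massC (A : {set 'I_N}) : 1 - mass pi A = \sum_(i | i \notin A) pi i.
Proof. by rewrite -pi_sum (bigID (mem A)) /= addrAC subrr add0r. Qed.

Lemma pi_lt1 i : pi i < 1.
Proof.
have [j ji] : exists j : 'I_N, j != i.
  have [i0|i0] := eqVneq i (Ordinal N_gt0); last by exists (Ordinal N_gt0); rewrite eq_sym.
  by exists (Ordinal N_gt1); rewrite i0.
rewrite -pi_sum (bigD1 i) //= ltrDl (bigD1 j) //=; apply: ltr_wpDr => //.
by apply: sumr_ge0 => h _; rewrite ltW.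
Qed.

Lemma topk1 (s : {perm 'I_N}) i : s i = Ordinal N_gt0 -> topk s 1 = [set i]%SET.
Proof.
move=> si; apply/setP => j; rewrite !inE -(inj_eq (@perm_inj _ s)) si.
by rewrite -val_eqE /= ltnS leqn0.
Qed.

Lemma mass_topkS (s : {perm 'I_N}) k (kN : (k < N)%N) :
  mass pi (topk s k.+1) = mass pi (topk s k) + pi ((s^-1)%g (Ordinal kN)).
Proof.
rewrite /mass (bigD1 ((s^-1)%g (Ordinal kN))) /=; last by rewrite inE permKV.
rewrite addrC; congr (_ + _); apply: eq_bigl => j.
rewrite !inE -(inj_eq (@perm_inj _ s)) permKV -val_eqE /=.
by rewrite ltnS andbC -ltn_neqAle.
Qed.

(** The first prefix whose mass reaches 1/2 overshoots by less than its last atom. *)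
Lemma mass_topk_near (s : {perm 'I_N}) q : (forall i, pi i < q) ->
  exists2 k, (1 <= k <= N)%N & 1/2 <= mass pi (topk s k) < 1/2 + q.
Proof.
move=> piq; have exk : exists k, 1/2 <= mass pi (topk s k).
  exists N; rewrite /mass (eq_bigl xpredT) ?pi_sum; first lra.
  by move=> i; rewrite inE ltn_ord.
case: (ex_minnP exk) => -[|k] mk kmin.
  by move: mk; rewrite /mass big_pred0 => [|i]; rewrite ?inE //; lra.
have kN : (k < N)%N.
  by apply: kmin; rewrite /mass (eq_bigl xpredT) ?pi_sum => [|i]; rewrite ?inE ?ltn_ord //; lra.
exists k.+1 => //; rewrite mk mass_topkS /=; apply: ltrD => //.
by rewrite ltNge; apply/negP => /kmin; rewrite ltnn.
Qed.

(** Collects what later arguments use of the query rule. The last two clauses compare the optimal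
    prefix with the one of length 1 and with the one from [mass_topk_near]. *)
Lemma sortPM_spec : exists i,
  [/\ i \in S, forall j, pi j <= pi i,
      forall j, j \notin S -> pi j * #|S|%:R <= mass pi S,
      `|mass pi S - 1/2| <= `|pi i - 1/2| &
      forall q, pi i < q -> `|mass pi S - 1/2| <= q].
Proof.
have [s [s_sort [k [/andP[k1 kN] kmin SE]]]] := S_sortPM.
pose i0 := (s^-1)%g (Ordinal N_gt0).
have si0 : s i0 = Ordinal N_gt0 by rewrite permKV.
have i0max j : pi j <= pi i0.
  have [->//|ji0] := eqVneq j i0; apply: s_sort; rewrite si0 /= lt0n.
  by apply: contraNneq ji0 => sj; rewrite -(inj_eq (@perm_inj _ s)) si0 -val_eqE /= sj.
exists i0; split=> //.
- by rewrite SE inE si0.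
- move=> j jS; rewrite mulr_natr -sumr_const; apply: ler_sum => i iS.
  apply: s_sort; move: iS jS; rewrite SE !inE -leqNgt; exact: leq_trans.
- have := kmin 1 N_gt0; rewrite -SE (topk1 si0).
  by rewrite [mass pi [set i0]%SET]big_set1.
- move=> q iq.
  have [k' k'N /andP[lo hi]] := @mass_topk_near s q (fun j => le_lt_trans (i0max j) iq).
  have := kmin k' k'N; rewrite -SE => /le_trans; apply.
  by rewrite ler_norml; apply/andP; split; lra.
Qed.

Lemma sortPM_mass_lt1 : mass pi S < 1.
Proof.
have [i [_ _ _ + _]] := sortPM_spec.
have := pi_lt1 i; have := pi_gt0 i; move: (pi i) (mass _ _) => x m x0 x1.
move=> /(le_trans (ler_norm _)) /le_lt_trans mx.
have : m - 1/2 < 1/2 by apply: mx; rewrite ltr_norml; apply/andP; split; lra.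
lra.
Qed.

Lemma sortPM_card_gt0 : (0 < #|S|)%N.
Proof. by have [i [iS _ _ _ _]] := sortPM_spec; apply/card_gt0P; exists i. Qed.

(** Each atom outside S is at most the average atom of S; summing over the complement gives (1 - m)
    |S| <= m (N - |S|). *)
Lemma sortPM_card_le_mass : #|S|%:R / N%:R <= mass pi S.
Proof.
have [_ [_ _ out _ _]] := sortPM_spec.
have N0 : (0 : R) < N%:R by rewrite ltr0n.
rewrite ler_pdivrMr //.
have : \sum_(j | j \notin S) pi j * #|S|%:R <= \sum_(j | j \notin S) mass pi S.
  by apply: ler_sum => j /out.
rewrite -mulr_suml -massC sumr_const -[leRHS]mulr_natr.
have := congr1 (fun n => n%:R : R) (cardC (mem S)); rewrite card_ord natrD.
rewrite (eq_card (_ : [predC S] =i [pred j | j \notin S])) // => <-.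
lra.
Qed.

(** Places the query fraction in the open interval on which [p] is controlled. *)
Lemma sortPM_frac : 0 < (#|S|%:R / N%:R : R) < 1.
Proof.
rewrite divr_gt0 ?ltr0n ?sortPM_card_gt0 //=.
exact: le_lt_trans sortPM_card_le_mass sortPM_mass_lt1.
Qed.

(** Beyond mass 1/2, any second element would move the prefix further from 1/2 than the top element
    alone. *)
Lemma sortPM_singleton i : (forall j, pi j <= pi i) -> 1/2 < pi i -> S = [set i]%SET.
Proof.
move=> imax ihalf; have [i' [i'S i'max _ near _]] := sortPM_spec.
have i'half : 1/2 < pi i' by apply: lt_le_trans ihalf _.
have small j : j != i' -> pi j < 1/2.
  move=> ji'; have := pi_sum; rewrite (bigD1 i') //= (bigD1 j) //=.
  have : 0 <= \sum_(h < N | (h != i') && (h != j)) pi h.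
    by apply: sumr_ge0 => h _; rewrite ltW.
  lra.
have -> : i = i'.
  by apply/eqP/negPn/negP => /small; lra.
apply/setP => j; rewrite inE; apply/idP/idP => [jS|/eqP->//].
apply/negPn/negP => ji'.
have : pi i' + pi j <= mass pi S.
  rewrite /mass (bigD1 i') //= (bigD1 j) //=; last by rewrite jS.
  by rewrite addrA lerDl; apply: sumr_ge0 => h _; rewrite ltW.
move: near; rewrite !ger0_norm; try lra.
  by have := pi_gt0 j; lra.
have : pi i' <= mass pi S.
  by rewrite /mass (bigD1 i') //= lerDl; apply: sumr_ge0 => h _; rewrite ltW.
lra.
Qed.

End SortPM.

(** * Bounding an expected stopping time by a potential *)

Section ExpectedStoppingTime.
Context {R : realType} {N : nat}.
Variables (next : ('I_N -> R) -> bool -> ('I_N -> R)) (eps : R).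
Implicit Types (w : 'I_N -> R) (t : nat).

Let alive w := ~~ stopb eps (normalize w).

(** Generalises [tail_prob] to any unnormalised start, so that the first observation can be peeled
    off recursively. *)
Definition tail_from w t : R :=
  \sum_(ys : t.-tuple bool) (\sum_i foldl next w ys i) *
    ([forall s : 'I_t.+1, alive (foldl next w (take s ys))])%:R.

Lemma sum_tuple_cons t (F : t.+1.-tuple bool -> R) :
  \sum_ys F ys = \sum_y \sum_(ys : t.-tuple bool) F [tuple of y :: ys].
Proof.
rewrite pair_bigA /=.
rewrite (reindex (fun yys : bool * t.-tuple bool => [tuple of yys.1 :: yys.2])) //=.
exists (fun ys => (thead ys, [tuple of behead ys])) => [[y ys]|ys] _.
  by rewrite theadE; congr (_, _); apply: val_inj.
by rewrite [RHS]tuple_eta; apply: val_inj.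
Qed.

Lemma forall_ord_recl t (P : pred 'I_t.+1) :
  [forall s, P s] = P ord0 && [forall s, P (lift ord0 s)].
Proof.
apply/forallP/andP => [Ps|[P0 /forallP Ps] s]; first by split=> //; apply/forallP.
by case: (unliftP ord0 s) => [s' ->|->].
Qed.

Lemma tail_from0 w : tail_from w 0 = (\sum_i w i) * (alive w)%:R.
Proof.
rewrite /tail_from (bigD1 [tuple]) //= [X in _ + X]big1 ?addr0; last first.
  by move=> ys /negP[]; apply/eqP; exact: tuple0.
by rewrite forall_ord_recl andb_idr // => _; apply/forallP => -[].
Qed.

Lemma tail_fromS w t :
  tail_from w t.+1 = (alive w)%:R * \sum_y tail_from (next w y) t.
Proof.
rewrite /tail_from sum_tuple_cons mulr_sumr; apply: eq_bigr => y _.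
rewrite mulr_sumr; apply: eq_bigr => ys _ /=.
rewrite forall_ord_recl take0 mulrCA; congr (_ * _).
by case: (alive w); rewrite /= ?mul1r ?mul0r.
Qed.

Variable V : ('I_N -> R) -> R.
Hypothesis next_gt0 : forall w, (forall i, 0 < w i) -> forall y i, 0 < next w y i.
Hypothesis V_ge0 : forall w, (forall i, 0 < w i) -> 0 <= V (normalize w).
Hypothesis V_drift : forall w, (forall i, 0 < w i) -> alive w ->
  \sum_i w i + \sum_y (\sum_i next w y i) * V (normalize (next w y)) <=
  (\sum_i w i) * V (normalize w).

(** Induction on the horizon: [V_drift] pays for the current step and the induction hypothesis for
    each successor, while all tails vanish once stopped. Total weights act as probabilities of
    observation histories. *)
Lemma sum_tail_from_le n w : (forall i, 0 < w i) ->
  \sum_(0 <= t < n) tail_from w t <= (\sum_i w i) * V (normalize w).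
Proof.
elim: n w => [|n IHn] w w0.
  by rewrite big_geq // mulr_ge0 ?V_ge0 // sumr_ge0 // => i _; rewrite ltW.
rewrite big_nat_recl // tail_from0 (eq_bigr _ (fun t _ => tail_fromS w t)).
rewrite -mulr_sumr exchange_big /=.
have [aw|_] := boolP (alive w); last first.
  rewrite mulr0 mul0r addr0.
  by rewrite mulr_ge0 ?V_ge0 // sumr_ge0 // => i _; rewrite ltW.
rewrite mulr1 mul1r; apply: le_trans (V_drift w0 aw); rewrite lerD2l.
by apply: ler_sum => y _; apply: IHn => i; exact: next_gt0.
Qed.

Lemma tail_from_ge0 w t : (forall i, 0 < w i) -> 0 <= tail_from w t.
Proof.
elim: t w => [|t IHt] w w0.
  by rewrite tail_from0 mulr_ge0 // sumr_ge0 // => i _; rewrite ltW.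
rewrite tail_fromS mulr_ge0 // sumr_ge0 // => y _.
by apply: IHt => i; exact: next_gt0.
Qed.

Lemma nneseries_tail_from_le w : (forall i, 0 < w i) ->
  (\sum_(t <oo) (tail_from w t)%:E <= ((\sum_i w i) * V (normalize w))%:E)%E.
Proof.
move=> w0; apply: lime_le.
  by apply: is_cvg_nneseries => t _ _; rewrite lee_fin tail_from_ge0.
by apply: nearW => n; rewrite sumEFin lee_fin; exact: sum_tail_from_le.
Qed.

End ExpectedStoppingTime.

(** * One-step drift of the four functionals and of the potential *)

Section Drift.
Context {R : realType} {N : nat}.
Variables (p : R -> R) (pi : 'I_N -> R) (S : {set 'I_N}) (q alpha eps : R).
Hypothesis p_mono : forall x y : R, 0 < x -> x <= y -> y < 1 -> p x <= p y.
Hypothesis p_range : forall x : R, 0 < x < 1 -> 0 < p x < 1/2.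
Hypothesis N_gt1 : (1 < N)%N.
Hypothesis pi_gt0 : forall i, 0 < pi i.
Hypothesis pi_sum : \sum_i pi i = 1.
Hypothesis S_sortPM : is_sortPM_query pi S.
Hypothesis q_range : 0 < q <= 1/4.
Hypothesis alpha_range : 0 < alpha < 1.
Hypothesis eps_range : 0 < eps < 1.

Let e := p (#|S|%:R / N%:R).
Let m := mass pi S.
Let l := bsc S e.
Let d := 1 - 2 * p (1 - q).

(** The Bhattacharyya coefficient of [mu] and the uniform law. *)
Definition affinity (mu : 'I_N -> R) := \sum_i Num.sqrt (mu i) / Num.sqrt N%:R.
Definition spread (mu : 'I_N -> R) := 1 - \sum_i mu i ^+ 2.
(** An unstopped atom has log-odds at most ln (1 / eps); the last term adds one jump under a
    singleton query. The first term is the floor, so it cancels from the range of the gap. *)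
Definition gap_top := logit (1 - q) + ln (1 / eps)
  + ln ((1 - p (1 / N%:R)) / p (1 / N%:R)).

Let e_range : 0 < e < 1/2.
Proof. exact/p_range/(sortPM_frac N_gt1 pi_gt0 pi_sum S_sortPM). Qed.

Let P_gt0 : forall y, 0 < outp pi l y := outp_gt0 pi_gt0 pi_sum (bsc_gt0 S e_range).
Let P_sum : outp pi l true + outp pi l false = 1 := outp_sum pi_sum (bsc_sum S e).

Let q_logit_ge0 : 0 <= logit (1 - q).
Proof.
case/andP: q_range => q0 q1; apply: ln_ge0.
by rewrite ler_pdivlMr; lra.
Qed.

Let lneps_ge0 : 0 <= ln (1 / eps).
Proof. by case/andP: eps_range => e0 e1; apply: ln_ge0; rewrite ler_pdivlMr; lra. Qed.

Lemma noise1_range : 0 < p (1 / N%:R) < 1/2.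
Proof.
apply: p_range; rewrite divr_gt0 ?ltr0n ?(ltnW N_gt1) //=.
by rewrite ltr_pdivrMr ?ltr0n ?(ltnW N_gt1) // mul1r ltr1n.
Qed.

Lemma gap_top_ge : logit (1 - q) <= gap_top.
Proof. by have := ln_odds_gt0 noise1_range; have := lneps_ge0; rewrite /gap_top; lra. Qed.

Lemma entropy_drift : \sum_y outp pi l y * entropy (bayes pi l y) <= entropy pi.
Proof. exact/entropy_bayes_le/bsc_sum/bsc_gt0. Qed.

Lemma affinity_drift_gen k : (forall i, 4 * k <= (l i true - outp pi l true) ^+ 2) ->
  \sum_y outp pi l y * affinity (bayes pi l y) <= (1 - k) * affinity pi.
Proof.
move=> hk.
have E mu : affinity mu = (\sum_i Num.sqrt (mu i)) / Num.sqrt N%:R by rewrite mulr_suml.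
rewrite E mulrA (eq_bigr _ (fun y _ => congr1 _ (E _))).
under eq_bigr => y _ do rewrite mulrA.
rewrite -mulr_suml; apply: ler_wpM2r; first by rewrite invr_ge0 sqrtr_ge0.
exact: (sum_sqrt_bayes_le pi_gt0 pi_sum (bsc_gt0 S e_range) (bsc_sum S e) hk).
Qed.

Lemma affinity_drift : \sum_y outp pi l y * affinity (bayes pi l y) <= affinity pi.
Proof.
rewrite -[leRHS]mul1r -[X in X * _]subr0; apply: affinity_drift_gen => i.
by rewrite mulr0 sqr_ge0.
Qed.

Lemma spread_drift_gen j : \sum_y outp pi l y * spread (bayes pi l y) <=
  spread pi - pi j ^+ 2 * (l j true - outp pi l true) ^+ 2.
Proof.
have := sum_sqr_bayes_ge pi_gt0 pi_sum (bsc_gt0 S e_range) (bsc_sum S e) j.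
rewrite /spread -/l !sum_bool => h.
have -> : outp pi l false = 1 - outp pi l true by rewrite -P_sum; ring.
move: h; have -> : outp pi l false = 1 - outp pi l true by rewrite -P_sum; ring.
lra.
Qed.

Lemma spread_drift : \sum_y outp pi l y * spread (bayes pi l y) <= spread pi.
Proof.
apply: le_trans (spread_drift_gen (Ordinal (ltnW N_gt1))) _.
by rewrite gerBl mulr_ge0 ?sqr_ge0.
Qed.

Let d_gt0 : 0 < d.
Proof.
case/andP: q_range => q0 q1; rewrite /d.
have /andP[_] : 0 < p (1 - q) < 1/2 by apply: p_range; apply/andP; split; lra.
lra.
Qed.

(** The queried fraction is at most the queried mass, so monotonicity of [p] keeps the noise away
    from 1/2 uniformly in N. *)
Let d_le : m <= 1 - q -> d <= 1 - 2 * e.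
Proof.
move=> mq; case/andP: q_range => q0 q1; rewrite /d.
have /andP[f0 _] := sortPM_frac N_gt1 pi_gt0 pi_sum S_sortPM.
have fm := sortPM_card_le_mass N_gt1 pi_sum S_sortPM.
have : e <= p (1 - q) by apply: p_mono => //; [exact: le_trans fm mq|lra].
lra.
Qed.

Lemma gap_drift_top i : (forall j, pi j <= pi i) -> 1 - q < pi i -> pi i <= 1 - eps ->
  \sum_y outp pi l y * gap (logit (1 - q)) gap_top (bayes pi l y) <=
  gap (logit (1 - q)) gap_top pi - (1 - 2 * q) * C1 (p (1 / N%:R)).
Proof.
move=> imax iq ieps; case/andP: q_range => q0 q1; case/andP: eps_range => ep0 ep1.
have Si : S = [set i]%SET by apply: (sortPM_singleton N_gt1 pi_gt0 pi_sum S_sortPM) => //; lra.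
have eE : e = p (1 / N%:R) by rewrite /e Si cards1.
have lt1 := pi_lt1 N_gt1 pi_gt0 pi_sum.
rewrite /l {1 2}Si -eE; apply: le_trans (gap_bayes_le _ _ _ _ _ _ _) _ => //.
- by apply: ler_logit (lt1 i) => //; lra.
- by move=> j; apply: ler_logit.
- rewrite /gap_top eE lerD2r.
  have : logit (pi i) <= ln (1 / eps); last by have := q_logit_ge0; lra.
  rewrite ler_ln ?posrE ?divr_gt0 ?subr_gt0 // ler_pdivrMr ?subr_gt0 //.
  by rewrite mul1r mulrC ler_pdivlMr //; nra.
- by rewrite lerD2l lerN2; apply: ler_wpM2r; [exact/ltW/C1_gt0|lra].
Qed.

Lemma gap_drift : (forall i, pi i <= 1 - eps) ->
  \sum_y outp pi l y * gap (logit (1 - q)) gap_top (bayes pi l y) <=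
  gap (logit (1 - q)) gap_top pi.
Proof.
move=> unstopped; case/andP: q_range => q0 q1.
have [i [_ imax _ _ _]] := sortPM_spec N_gt1 pi_sum S_sortPM.
have [iq|iq] := ltP (1 - q) (pi i).
  apply: le_trans (gap_drift_top imax iq (unstopped i)) _.
  by rewrite gerBl mulr_ge0 ?ltW ?C1_gt0 ?noise1_range //; lra.
(* Here the gap already has its maximal value, so no update can increase it. *)
have : gap_top - logit (1 - q) <= gap (logit (1 - q)) gap_top pi.
  apply: gap_ge => // j; apply: ler_logit => //; last lra.
  exact: le_trans iq.
apply: le_trans; rewrite -[leRHS]mul1r -P_sum -sum_bool mulr_suml.
by apply: ler_sum => y _; apply: ler_wpM2l; [exact: ltW|exact: gap_le].
Qed.

(** One factor q comes from pi_i >= q, the other from 1 - m >= q, the factor d from [d_le]. *)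
Lemma spread_drift_mid i : (forall j, pi j <= pi i) -> i \in S ->
  `|m - 1/2| <= `|pi i - 1/2| -> q <= pi i <= 1 - q ->
  \sum_y outp pi l y * spread (bayes pi l y) <= spread pi - (q ^+ 2 * d) ^+ 2.
Proof.
move=> imax iS near /andP[iq1 iq2]; case/andP: q_range => q0 q1.
have mq : m <= 1 - q.
  have : `|pi i - 1/2| <= 1/2 - q by rewrite ler_norml; apply/andP; split; lra.
  by move/(le_trans near)/(le_trans (ler_norm _)); lra.
apply: le_trans (spread_drift_gen i) _; rewrite lerD2l lerN2 -exprMn.
rewrite /l bsc_sub_outp // iS -/(mass pi S) -/m.
have dle := d_le mq; have d0 := d_gt0.
rewrite ler_sqr ?nnegrE; last 2 first.
- by rewrite mulr_ge0 ?sqr_ge0 ?ltW.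
- by rewrite !mulr_ge0 //; lra.
rewrite expr2 -mulrA; apply: ler_pM => //; [lra|by rewrite mulr_ge0 ?ltW|].
by apply: ler_pM => //; lra.
Qed.

(** The contraction constant (d / 8)^2, from m and 1 - m being at least 1/4, times a lower bound on
    the affinity. *)
Definition affinity_rate : R := (d / 8) ^+ 2 * (Num.sqrt alpha / 4).

Lemma affinity_drift_spread : `|m - 1/2| <= q -> alpha < #|S|%:R / N%:R ->
  \sum_y outp pi l y * affinity (bayes pi l y) <= affinity pi - affinity_rate.
Proof.
rewrite ler_norml => /andP[m1 m2] aS; case/andP: q_range => q0 q1.
have dle : d <= 1 - 2 * e by apply: d_le; lra.
have d0 := d_gt0.
apply: le_trans (@affinity_drift_gen ((d / 8) ^+ 2) _) _ => [i|].
  rewrite /l bsc_sub_outp // -/(mass pi S) -/m.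
  have -> : 4 * (d / 8) ^+ 2 = (1/4 * d) ^+ 2 by field.
  rewrite exprMn [leRHS]exprMn; apply: ler_pM; rewrite ?sqr_ge0 //.
    by case: ifP => _; rewrite ?sqrrN ler_sqr ?nnegrE; lra.
  by rewrite ler_sqr ?nnegrE; lra.
rewrite mulrBl mul1r lerD2l lerN2; apply: ler_wpM2l; first exact: sqr_ge0.
have [_ [_ _ out _ _]] := sortPM_spec N_gt1 pi_sum S_sortPM.
have N0 : (0 : R) < N%:R by rewrite ltr0n (ltnW N_gt1).
case/andP: alpha_range => a0 a1.
have sN : 0 < Num.sqrt (N%:R : R) by rewrite sqrtr_gt0.
(* An atom outside S is at most m / |S| < 1 / (alpha N), so sqrt (pi_j / N) >= sqrt alpha * pi_j;
   these terms sum to the middle value. *)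
apply: (@le_trans _ _ (Num.sqrt alpha * (1 - m))).
  by apply: ler_wpM2l; [exact: sqrtr_ge0|lra].
rewrite massC // mulr_sumr /affinity [leRHS](bigID (mem S)) /=.
apply: ler_wpDl; first by apply: sumr_ge0 => i _; rewrite divr_ge0 ?sqrtr_ge0.
apply: ler_sum => j jS; rewrite ler_pdivlMr //.
have pj := pi_gt0 j.
have sp : 0 < Num.sqrt (pi j) by rewrite sqrtr_gt0.
rewrite -{1}[pi j](@sqr_sqrtr _ (pi j)) ?(ltW pj) //.
have -> : Num.sqrt alpha * Num.sqrt (pi j) ^+ 2 * Num.sqrt N%:R =
  Num.sqrt (pi j) * Num.sqrt (alpha * N%:R * pi j).
  by rewrite !sqrtrM ?mulr_ge0 ?(ltW a0) ?(ltW N0) //; ring.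
rewrite -[leRHS]mulr1; apply: ler_wpM2l; first exact: ltW.
rewrite -[leRHS]sqrtr1 ler_wsqrtr //.
have := out j jS; have := sortPM_mass_lt1 N_gt1 pi_gt0 pi_sum S_sortPM.
move: aS; rewrite ltr_pdivlMr // -/m => aS mlt pjS.
have : pi j * (alpha * N%:R) <= pi j * #|S|%:R by apply: ler_wpM2l; apply: ltW.
lra.
Qed.

Lemma entropy_drift_near : `|m - 1/2| <= q -> #|S|%:R / N%:R <= alpha ->
  \sum_y outp pi l y * entropy (bayes pi l y) <= entropy pi - (MI (1/2) (p alpha) - q).
Proof.
rewrite ler_norml => /andP[m1 m2] aS; case/andP: q_range => q0 q1.
case/andP: alpha_range => a0 a1.
apply: le_trans (entropy_bsc_le _ pi_gt0 pi_sum e_range) _; rewrite -/(mass pi S) -/m.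
have /andP[_ pa] := p_range alpha_range; case/andP: (e_range) => e0 _.
have /andP[f0 _] := sortPM_frac N_gt1 pi_gt0 pi_sum S_sortPM.
have := MI_half_anti e0 (p_mono f0 aS a1) pa.
(* |2m - 1| <= 2q and 4 q^2 <= q because q <= 1/4. *)
have : (2 * m - 1) ^+ 2 <= q by nra.
lra.
Qed.

(** Each functional is divided by its guaranteed drop in its own regime, so that one of the four
    always pays a full unit. *)
Definition potential (mu : 'I_N -> R) :=
  entropy mu / (MI (1/2) (p alpha) - q)
  + gap (logit (1 - q)) gap_top mu / ((1 - 2 * q) * C1 (p (1 / N%:R)))
  + affinity mu / affinity_rate + spread mu / (q ^+ 2 * d) ^+ 2.

Lemma sum_potential : \sum_y outp pi l y * potential (bayes pi l y) =
  (\sum_y outp pi l y * entropy (bayes pi l y)) / (MI (1/2) (p alpha) - q)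
  + (\sum_y outp pi l y * gap (logit (1 - q)) gap_top (bayes pi l y))
      / ((1 - 2 * q) * C1 (p (1 / N%:R)))
  + (\sum_y outp pi l y * affinity (bayes pi l y)) / affinity_rate
  + (\sum_y outp pi l y * spread (bayes pi l y)) / (q ^+ 2 * d) ^+ 2.
Proof. by rewrite /potential !sum_bool; ring. Qed.

Lemma potential_drift : q < MI (1/2) (p alpha) -> (forall i, pi i <= 1 - eps) ->
  1 + \sum_y outp pi l y * potential (bayes pi l y) <= potential pi.
Proof.
move=> qMI unstopped; case/andP: q_range => q0 q1; case/andP: alpha_range => a0 _.
have [i [iS imax _ near small]] := sortPM_spec N_gt1 pi_sum S_sortPM.
rewrite sum_potential /potential.
have drop (x y c : R) : 0 < c -> x <= y - c -> 1 + x / c <= y / c.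
  by move=> c0 xy; rewrite -{1}(divff (lt0r_neq0 c0)) -mulrDl ler_pM2r ?invr_gt0 //; lra.
have keep (x y c : R) : 0 < c -> x <= y -> x / c <= y / c.
  by move=> c0 xy; rewrite ler_pM2r ?invr_gt0.
have c1 : 0 < MI (1/2) (p alpha) - q by rewrite subr_gt0.
have c2 : 0 < (1 - 2 * q) * C1 (p (1 / N%:R)).
  by apply: mulr_gt0; [lra|exact/C1_gt0/noise1_range].
have c3 : 0 < affinity_rate.
  by rewrite mulr_gt0 ?exprn_gt0 ?divr_gt0 ?sqrtr_gt0.
have c4 : 0 < (q ^+ 2 * d) ^+ 2 by rewrite exprn_gt0 // mulr_gt0 // exprn_gt0.
have k1 := keep _ _ _ c1 entropy_drift.
have k2 := keep _ _ _ c2 (gap_drift unstopped).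
have k3 := keep _ _ _ c3 affinity_drift.
have k4 := keep _ _ _ c4 spread_drift.
have [iq|iq] := ltP (1 - q) (pi i).
  have := drop _ _ _ c2 (gap_drift_top imax iq (unstopped i)); lra.
have [iq'|/small mq] := leP q (pi i).
  have iqq : q <= pi i <= 1 - q by rewrite iq'.
  have := drop _ _ _ c4 (spread_drift_mid imax iS near iqq); lra.
have [Sa|Sa] := leP (#|S|%:R / N%:R) alpha.
  have := drop _ _ _ c1 (entropy_drift_near mq Sa); lra.
have := drop _ _ _ c3 (affinity_drift_spread mq Sa); lra.
Qed.

End Drift.

(** * From the drift to a bound on the expected search time *)

Section SearchTime.
Context {R : realType} {N : nat}.
Variables (p : R -> R) (sel : ('I_N -> R) -> {set 'I_N}) (q alpha eps : R).
Hypothesis p_mono : forall x y : R, 0 < x -> x <= y -> y < 1 -> p x <= p y.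
Hypothesis p_range : forall x : R, 0 < x < 1 -> 0 < p x < 1/2.
Hypothesis sel_sortPM : forall mu, is_sortPM_query mu (sel mu).
Hypothesis N_gt1 : (1 < N)%N.
Hypothesis q_range : 0 < q <= 1/4.
Hypothesis alpha_range : 0 < alpha < 1.
Hypothesis eps_range : 0 < eps < 1.
Hypothesis q_lt_MI : q < MI (1/2) (p alpha).

Let V := @potential R N p q alpha eps.
Let N_gt0 : (0 : R) < N%:R.
Proof. by rewrite ltr0n (ltnW N_gt1). Qed.

Let rate_gt0 : 0 < affinity_rate p q alpha /\ 0 < (q ^+ 2 * (1 - 2 * p (1 - q))) ^+ 2.
Proof.
case/andP: q_range => q0 q1; case/andP: alpha_range => a0 _.
have /andP[_ pq] : 0 < p (1 - q) < 1/2 by apply: p_range; apply/andP; split; lra.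
have d0 : 0 < 1 - 2 * p (1 - q) by lra.
by split; rewrite ?mulr_gt0 ?exprn_gt0 ?divr_gt0 ?sqrtr_gt0 ?mulr_gt0 ?exprn_gt0.
Qed.

Let C1_rate_gt0 : 0 < (1 - 2 * q) * C1 (p (1 / N%:R)).
Proof.
case/andP: q_range => q0 q1.
by apply: mulr_gt0; [lra|exact/C1_gt0/(noise1_range p_range N_gt1)].
Qed.

Let total_gt0 (w : 'I_N -> R) : (forall i, 0 < w i) -> 0 < \sum_i w i.
Proof.
move=> w0; rewrite (bigD1 (Ordinal (ltnW N_gt1))) //=; apply: ltr_wpDr => //.
by apply: sumr_ge0 => i _; rewrite ltW.
Qed.

Lemma normalize_gt0 (w : 'I_N -> R) : (forall i, 0 < w i) -> forall i, 0 < normalize w i.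
Proof. by move=> w0 i; rewrite divr_gt0 ?total_gt0. Qed.

Lemma normalize_sum (w : 'I_N -> R) : (forall i, 0 < w i) -> \sum_i normalize w i = 1.
Proof. by move=> w0; rewrite -mulr_suml divff // gt_eqF // total_gt0. Qed.

Lemma potential_ge0 (mu : 'I_N -> R) : (forall i, 0 < mu i) -> \sum_i mu i = 1 -> 0 <= V mu.
Proof.
move=> mu0 mu1; have [r0 s0] := rate_gt0.
have le1 i : mu i <= 1 by exact/ltW/pi_lt1.
rewrite /V /potential !addr_ge0 // divr_ge0 ?(ltW r0) ?(ltW s0) ?(ltW C1_rate_gt0) //.
- rewrite oppr_ge0; apply: sumr_le0 => i _.
  by rewrite mulr_ge0_le0 ?ln_le0 // ltW.
- by rewrite subr_ge0 ltW.
- exact/gap_ge0/gap_top_ge.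
- by apply: sumr_ge0 => i _; rewrite divr_ge0 ?sqrtr_ge0.
- rewrite subr_ge0 -mu1; apply: ler_sum => i _.
  by rewrite expr2 -[leRHS]mulr1; apply: ler_wpM2l; [exact: ltW|exact: le1].
Qed.

Lemma step_gt0 (w : 'I_N -> R) : (forall i, 0 < w i) -> forall y i, 0 < step p sel w y i.
Proof.
move=> w0 y i; rewrite /step mulr_gt0 //.
apply: bsc_gt0; apply/p_range/sortPM_frac.
- exact: N_gt1.
- exact: normalize_gt0.
- exact: normalize_sum.
- exact: sel_sortPM.
Qed.

(** The new weights are the old total times prior times likelihood; factoring out the total reduces
    the claim to [potential_drift]. *)
Lemma potential_step (w : 'I_N -> R) : (forall i, 0 < w i) ->
  ~~ stopb eps (normalize w) ->
  \sum_i w i + \sum_y (\sum_i step p sel w y i) * V (normalize (step p sel w y)) <=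
  (\sum_i w i) * V (normalize w).
Proof.
move=> w0 /existsPn unstopped; have W0 := total_gt0 w0.
set S := sel (normalize w); pose l := bsc S (p (#|S|%:R / N%:R)).
have stepE y i : step p sel w y i = (\sum_j w j) * (normalize w i * l i y).
  by rewrite /normalize mulrA mulrCA divff ?gt_eqF // mulr1.
have sumE y : \sum_i step p sel w y i = (\sum_j w j) * outp (normalize w) l y.
  by rewrite mulr_sumr; apply: eq_bigr => i _.
have normE y : normalize (step p sel w y) = bayes (normalize w) l y.
  apply: funext => i; rewrite [LHS]/normalize sumE stepE /bayes.
  by rewrite -mulf_div divff ?mul1r // gt_eqF.
have E y : (\sum_i step p sel w y i) * V (normalize (step p sel w y)) =
    (\sum_j w j) * (outp (normalize w) l y * V (bayes (normalize w) l y)).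
  by rewrite sumE normE mulrA.
rewrite (eq_bigr _ (fun y _ => E y)).
rewrite -mulr_sumr -{1}[\sum_i w i]mulr1 -mulrDr ler_pM2l //.
apply: (potential_drift p_mono p_range N_gt1) => //.
- exact: normalize_gt0.
- exact: normalize_sum.
- by move=> i; rewrite leNgt; exact: unstopped.
Qed.

Lemma Etau_le_potential : (Etau p sel eps <= (V (fun=> 1 / N%:R))%:E)%E.
Proof.
have u0 (i : 'I_N) : 0 < 1 / N%:R :> R by rewrite divr_gt0.
have u1 : \sum_(i < N) 1 / N%:R = 1 :> R.
  by rewrite sumr_const card_ord -[LHS]mulr_natr divfK // gt_eqF.
have := @nneseries_tail_from_le R N (step p sel) eps V step_gt0
  (fun w w0 => potential_ge0 (normalize_gt0 w0) (normalize_sum w0)) potential_step _ u0.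
rewrite u1 [X in X%:E]mul1r; set w := (X in normalize X).
have -> // : normalize w = w.
by apply: funext => i; rewrite /normalize [X in _ / X]u1 divr1.
Qed.

(** At the uniform law the entropy is ln N, the affinity is 1, the spread is at most 1 and the gap
    at most its range. *)
Lemma potential_uniform_le : V (fun=> 1 / N%:R) <=
  ln N%:R / (MI (1/2) (p alpha) - q)
  + (ln (1 / eps) + ln ((1 - p (1 / N%:R)) / p (1 / N%:R)))
      / ((1 - 2 * q) * C1 (p (1 / N%:R)))
  + (affinity_rate p q alpha)^-1 + ((q ^+ 2 * (1 - 2 * p (1 - q))) ^+ 2)^-1.
Proof.
have [r0 s0] := rate_gt0.
have -> : ln N%:R = entropy (fun _ : 'I_N => 1 / N%:R) :> R.
  rewrite /entropy sumr_const card_ord -[X in - X]mulr_natr div1r lnV ?posrE //.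
  by field; rewrite gt_eqF.
rewrite /V /potential; apply: lerD; first apply: lerD; first rewrite lerD2l.
- rewrite ler_pM2r ?invr_gt0 //; apply: le_trans (gap_le _ _ _) _.
  by rewrite /gap_top; lra.
- have -> : affinity (fun _ : 'I_N => 1 / N%:R) = 1 :> R; last by rewrite mul1r.
  rewrite /affinity sumr_const card_ord -[LHS]mulr_natr div1r sqrtrV ?(ltW N_gt0) // -invfM -expr2.
  by rewrite sqr_sqrtr ?(ltW N_gt0) // mulVf // gt_eqF.
- rewrite -[leRHS]mul1r ler_pM2r ?invr_gt0 //.
  by rewrite /spread gerBl sumr_ge0 // => i _; rewrite sqr_ge0.
Qed.

End SearchTime.

(** * Choice of constants and the little-o term *)

Theorem theorem1 (R : realType) (p : R -> R)
  (p_cont : forall x : R, 0 < x < 1 -> {for x, continuous p})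
  (p_mono : forall x y : R, 0 < x -> x <= y -> y < 1 -> p x <= p y)
  (p_range : forall x : R, 0 < x < 1 -> 0 < p x < 1/2)
  (sel : forall N : nat, ('I_N -> R) -> {set 'I_N})
  (sel_sortPM : forall (N : nat) (pi : 'I_N -> R),
     (0 < N)%N -> is_sortPM_query pi (sel N pi)) :
  0 < Ks p /\
  forall alpha : R, 0 < alpha < 1 ->
  forall eta : R, 0 < eta ->
  exists M : R, forall (N : nat) (eps : R),
    (1 < N)%N -> 0 < eps < 1 ->
    let L := ln (N%:R / eps) in
    M <= L ->
    powR (expR 1 * L) (- Ks p) < alpha ->
    (Etau p (sel N) eps <=
      (ln N%:R / MI (1/2) (p alpha)
       + ln (1 / eps) / C1 (p (1 / N%:R))
       + eta * L)%:E)%E.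
Proof.
have half : 0 < (1/2 : R) < 1 by apply/andP; split; lra.
split; first exact/Ks_gt0/p_range.
move=> alpha alpha_range eta eta0.
set I := MI (1/2) (p alpha); have I0 : 0 < I by exact/MI_half_gt0/p_range.
pose c := C1 (p (1/2)); have c0 : 0 < c by exact/C1_gt0/p_range.
(* With q <= I/2, the third bound gives 1 / (I - q) <= 1 / I + eta / 3; the fourth does the same for
   C1. Taking [c] at 1/2, where C1 is smallest over all 1/N with N > 1, makes q independent of N. *)
pose q := Num.min (1/4) (Num.min (I/2) (Num.min (eta * I ^+ 2 / 6) (eta * c / 12))).
have q0 : 0 < q by rewrite !lt_min !divr_gt0 ?mulr_gt0 ?exprn_gt0.
have [q1 q2 q3 q4] : [/\ q <= 1/4, q <= I/2, q <= eta * I ^+ 2 / 6 & q <= eta * c / 12].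
  by split; rewrite !ge_min lexx ?orbT.
have q_range : 0 < q <= 1/4 by rewrite q0.
clearbody q.
have /andP[ph0 ph1] := p_range _ half.
(* Bounds every term free of ln N and ln (1 / eps); the threshold 3 K / eta makes it at most eta L /
   3. *)
pose K := 2 / (1 - 2 * p (1/2)) + (affinity_rate p q alpha)^-1
  + ((q ^+ 2 * (1 - 2 * p (1 - q))) ^+ 2)^-1.
exists (3 * K / eta) => N eps N1 eps_range /= ML _.
have N0 : (0 : R) < N%:R by rewrite ltr0n (ltnW N1).
case/andP: (eps_range) => eps0 eps1.
have lnN0 : 0 <= ln (N%:R : R) by apply: ln_ge0; rewrite ler1n (ltnW N1).
have lneps0 : 0 <= ln (1 / eps) by apply: ln_ge0; rewrite ler_pdivlMr //; lra.
have LE : ln (N%:R / eps) = ln N%:R + ln (1 / eps).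
  by rewrite !ln_div ?posrE // ln1; ring.
rewrite LE in ML *.
have qI : q < MI (1/2) (p alpha) by rewrite -/I; lra.
apply: le_trans (Etau_le_potential p_mono p_range (fun mu => sel_sortPM _ mu (ltnW N1))
  N1 q_range alpha_range eps_range qI) _.
rewrite lee_fin; apply: le_trans (potential_uniform_le eps p_range N1 q_range alpha_range) _.
rewrite -/I; set p1 := p (1 / N%:R).
have p1_range : 0 < p1 < 1/2 := noise1_range p_range N1.
case/andP: (p1_range) => p10 p11.
have p1h : p1 <= p (1/2).
  apply: p_mono; [by rewrite divr_gt0| |lra].
  by rewrite !mul1r lef_pV2 ?posrE // ler_nat.
have cC1 : c <= C1 p1 by exact: C1_anti.
have C10 : 0 < C1 p1 by exact: C1_gt0.
have entropy_part : ln N%:R / (I - q) <= ln N%:R / I + eta / 3 * ln N%:R.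
  rewrite [eta / 3 * _]mulrC -mulrDr; apply: ler_wpM2l => //.
  rewrite -div1r ler_pdivrMr; last lra.
  have -> : (I^-1 + eta / 3) * (I - q) = 1 + (eta / 3 * (I - q) - q / I).
    by field; rewrite gt_eqF.
  rewrite lerDl subr_ge0 ler_pdivrMr //; nra.
have gap_part : ln (1 / eps) / ((1 - 2 * q) * C1 p1) <=
    ln (1 / eps) / C1 p1 + eta / 3 * ln (1 / eps).
  rewrite [eta / 3 * _]mulrC -mulrDr; apply: ler_wpM2l => //.
  rewrite -div1r ler_pdivrMr; last by apply: mulr_gt0 => //; lra.
  have -> : ((C1 p1)^-1 + eta / 3) * ((1 - 2 * q) * C1 p1) =
    1 + (eta / 3 * (1 - 2 * q) * C1 p1 - 2 * q) by field; rewrite gt_eqF.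
  have eC : eta * c <= eta * C1 p1 by rewrite ler_pM2l.
  have : 0 <= eta * C1 p1 * (1/2 - 2 * q) by apply: mulr_ge0; [rewrite mulr_ge0 // ltW|lra].
  rewrite lerDl subr_ge0; lra.
(* The jump size cancels against the same logarithm inside C1, so the bound holds however small
   p[1/N] is. *)
have jump_part : ln ((1 - p1) / p1) / ((1 - 2 * q) * C1 p1) <= 2 / (1 - 2 * p (1/2)).
  have b0 := ln_odds_gt0 p1_range.
  rewrite C1E; last by apply/andP; split; lra.
  have -> : ln ((1 - p1) / p1) / ((1 - 2 * q) * ((1 - 2 * p1) * ln ((1 - p1) / p1))) =
      1 / ((1 - 2 * q) * (1 - 2 * p1)).
    by field; rewrite !gt_eqF //; lra.
  rewrite ler_pdivrMr; last by apply: mulr_gt0; lra.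
  rewrite mulrAC ler_pdivlMr; last lra.
  nra.
have : K <= eta / 3 * (ln N%:R + ln (1 / eps)).
  by move: ML; rewrite ler_pdivrMr //; lra.
have : 0 <= eta * (ln N%:R + ln (1 / eps)) by rewrite mulr_ge0 ?addr_ge0 // ltW.
rewrite /K [(_ + ln (_ / p1)) / _]mulrDl; lra.
Qed.
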